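(* Let $G$ be a bidirected graph in which every connected component contains at least one adjacency, and let $u\in V$. Then $\mathfrak{C}(G)/(\sim_{u\bullet}\circ\sim_a)$ is a refinement of each activation class $\mathcal{A}\in\mathfrak{C}(G)/\sim_a$ into two principal order ideals of $(\mathcal{A},\leq_a)$, one lower and one upper, with the upper order ideal possibly empty, that are boolean complements. Moreover, the upper order ideal of the activation class $\mathcal{A}$ is empty if, and only if, $c(h_u)=u$ for all $c\in\mathcal{A}$.
   Context: A bidirected graph is a quintuple $G=(V,E,I,\iota,\sigma)$ where $V,E,I$ are disjoint finite sets (vertices, edges, incidences), $V$ nonempty, $\iota:I\to V\times E$ and $\sigma:I\to\{+1,-1\}$ are functions, and every edge belongs to exactly two incidences. Parallel edges and loops are allowed. Let $\overrightarrow{P}_1$ be the directed path of length 1. An incidence preserving map $\overrightarrow{P}_1\to G$ is the same as a sequence $(v,i,e,j,w)$ with $\iota(i)=(v,e)$, $\iota(j)=(w,e)$ (tail sent to $v$, head sent to $w$). It is a backstep if $i=j$, and a directed adjacency if $i\ne j$ (a loop if also $v=w$). A pre-contributor of $G$ is an incidence preserving map $p:\coprod_{v\in V}\overrightarrow{P}_1\to G$ (one copy $(\overrightarrow{P}_1)_v$ with tail $t_v$, head $h_v$ for each $v\in V$) with $p(t_v)=v$ for all $v$. A contributor is a pre-contributor with $\{p(h_v)\mid v\in V\}=V$; $\mathfrak{C}(G)$ is the set of contributors. Unpacking a pre-contributor at a vertex $v$ where $p((\overrightarrow{P}_1)_v)=(v,i,e,i,v)$ is a backstep means replacing this value by $(v,i,e,j,w)$,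 where $j\neq i$ is the other incidence of $e$ and $\iota(j)=(w,e)$, leaving all other values unchanged. Packing is the inverse operation, replacing $(v,i,e,j,w)$ with $i\ne j$ by $(v,i,e,i,v)$. For a contributor $c$, the permutation $v\mapsto c(h_v)$ decomposes its image into cycles; $tc(c)$ is the number of these which are not single backsteps (loops and closed weak walks of length 2 formed by two directed adjacencies count as circles). Activating a circle of $c$ is a minimal sequence of unpackings resulting in a contributor $c'$ with $tc(c')=tc(c)+1$. The activation partial order is: $c\leq_a d$ if $d$ is obtained from $c$ by a (possibly empty) sequence of activations. $\sim_a$ is the equivalence relation on $\mathfrak{C}(G)$ generated by comparability under $\leq_a$, and its classes are called activation classes. Each activation class, ordered by $\leq_a$, is a boolean lattice. For $u,w\in V$, $c\sim_{uw}d$ means $c(h_u)=d(h_u)=w$; $\sim_{u\bullet}$ is the composite of all $\sim_{uw}$, $w\in V$, i.e. contributors are grouped according to the value $c(h_u)$. Thus the blocks of $\mathfrak{C}(G)/(\sim_{u\bullet}\circ\sim_a)$ inside $\mathcal{A}$ are the nonempty sets among $\{c\in\mathcal{A}\mid c(h_u)=w\}$, $w\in V$; the lower order ideal is the block with $w=u$. A principal lower order ideal of $\mathcal{A}$ is a set $\downarrow M=\{c\in\mathcal A\mid c\leq_a M\}$ and a principal upper order ideal is a set $\uparrow m=\{c\in\mathcal A\mid m\leq_a c\}$. Two such ideals $\downarrow M$, $\uparrow m$ are boolean complements if $\mathcal{A}$ is their disjoint union and $M$, $m$ are complementary elements of the boolean lattice $\mathcal{A}$ (when the upper ideal is empty,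 this means $\downarrow M=\mathcal{A}$). *)

(* Defs.v *)
From HB Require Import structures.
From Stdlib Require Import Relation_Operators.
From mathcomp Require Import all_boot all_order all_algebra all_fingroup.
From mathcomp Require Import boolp classical_sets.
Set Implicit Arguments.
Unset Strict Implicit.
Unset Printing Implicit Defensive.

Local Open Scope classical_set_scope.

(* The sets V, E, I are carriers of distinct types, hence disjoint. *)
Record bidirected_graph := BidirectedGraph {
  vertex : finType;
  edge : finType;
  incidence : finType;
  iota : incidence -> vertex * edge;
  sigma : incidence -> int;
  vertex_nonempty : 0 < #|vertex|;
  sigma_sign : forall i, sigma i = 1%R \/ sigma i = (-1)%R;
  edge_two_incidences : forall e, #|[pred i | (iota i).2 == e]| = 2
}.

(* Incidence preserving maps from the directed path of length 1 to G, as
   sequences (v, i, e, j, w): tail, tail incidence, edge, head incidence,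
   head. *)
Definition incidence_preserving (G : bidirected_graph)
    (x : vertex G * incidence G * edge G * incidence G * vertex G) : bool :=
  let: (v, i, e, j, w) := x in (iota i == (v, e)) && (iota j == (w, e)).

Record p1map (G : bidirected_graph) := P1Map {
  p1seq : vertex G * incidence G * edge G * incidence G * vertex G;
  p1seqP : incidence_preserving p1seq
}.
HB.instance Definition _ (G : bidirected_graph) := [isSub for @p1seq G].
HB.instance Definition _ (G : bidirected_graph) :=
  [Finite of p1map G by <:].

Section P1Map.
Variables (G : bidirected_graph) (x : p1map G).

Definition p1tail : vertex G := let: (v, i, e, j, w) := p1seq x in v.
Definition p1tail_inc : incidence G := let: (v, i, e, j, w) := p1seq x in i.
Definition p1head_inc : incidence G := let: (v, i, e, j, w) := p1seq x in j.
Definition p1head : vertex G := let: (v, i, e, j, w) := p1seq x in w.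

Definition backstep : bool := p1tail_inc == p1head_inc.
Definition directed_adjacency : bool := p1tail_inc != p1head_inc.

End P1Map.

Definition adjacent (G : bidirected_graph) : rel (vertex G) :=
  fun v w => [exists x : p1map G,
    [&& directed_adjacency x, p1tail x == v & p1head x == w]].

(* Every edge meets a vertex, so each connected component is that of some
   vertex z. Loops count as adjacencies. *)
Definition components_have_adjacency (G : bidirected_graph) : Prop :=
  forall z : vertex G, exists x : p1map G,
    [/\ directed_adjacency x,
        connect (@adjacent G) z (p1tail x) &
        connect (@adjacent G) z (p1head x)].

Record precontributor (G : bidirected_graph) := Precontributor {
  pcfun :> {ffun vertex G -> p1map G};
  pcfunP : [forall v, p1tail (pcfun v) == v]
}.
HB.instance Definition _ (G : bidirected_graph) := [isSub for @pcfun G].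
HB.instance Definition _ (G : bidirected_graph) :=
  [Finite of precontributor G by <:].

Definition chead (G : bidirected_graph) (p : precontributor G) (v : vertex G) :
  vertex G := p1head (p v).

Record contributor (G : bidirected_graph) := Contributor {
  cpre :> precontributor G;
  cpreP : (chead cpre @: [set: vertex G])%SET == [set: vertex G]%SET
}.
HB.instance Definition _ (G : bidirected_graph) := [isSub for @cpre G].
HB.instance Definition _ (G : bidirected_graph) :=
  [Finite of contributor G by <:].

Section Activation.
Variable G : bidirected_graph.
Implicit Types (p q r : precontributor G) (c d : contributor G).

Lemma chead_inj c : injective (chead c).
Proof.
have /imset_injP inj :
    #|(chead c @: [set: vertex G])%SET| == #|[set: vertex G]%SET|.
  by rewrite (eqP (cpreP c)).
by move=> v w; apply: inj; rewrite inE.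
Qed.

Definition head_perm c : {perm vertex G} := perm (@chead_inj c).

Definition tc c : nat :=
  #|[pred X in porbits (head_perm c) |
      ~~ [exists v, (X == [set v]%SET) && backstep (c v)]]|.

(* An edge has exactly two incidences, so q is determined by p and v. *)
Definition unpack_at (v : vertex G) p q : Prop :=
  [/\ backstep (p v), directed_adjacency (q v),
      p1tail_inc (q v) = p1tail_inc (p v) &
      forall w, w != v -> q w = p w].

Fixpoint unpack_seq (s : seq (vertex G)) p q : Prop :=
  if s is v :: s' then exists2 r, unpack_at v p r & unpack_seq s' r q
  else p = q.

Definition unpacks_circle (s : seq (vertex G)) c d : Prop :=
  unpack_seq s c d /\ tc d = (tc c).+1.

(* Minimality: no proper subsequence of the unpackings already results in
   some contributor with one more circle. *)
Definition activates c d : Prop :=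
  exists2 s, unpacks_circle s c d &
    forall (t : seq (vertex G)) d',
      subseq t s -> unpacks_circle t c d' -> t = s.

Definition le_a : contributor G -> contributor G -> Prop :=
  clos_refl_trans (contributor G) activates.

Definition sim_a : contributor G -> contributor G -> Prop :=
  clos_refl_sym_trans (contributor G) le_a.

Definition sim_at (u w : vertex G) c d : Prop := chead c u = w /\ chead d u = w.

Definition sim_from (u : vertex G) c d : Prop := exists w, sim_at u w c d.

(* The composite of the two relations groups the members of each activation
   class by the head of u: it is their common refinement, not the relational
   product. *)
Definition sim_from_a (u : vertex G) c d : Prop := sim_from u c d /\ sim_a c d.

End Activation.

Definition quotient (T : Type) (R : T -> T -> Prop) : set (set T) :=
  [set B | exists c, B = [set d | R c d]].

Definition refines (T : Type) (P Q : set (set T)) : Prop :=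
  forall B, P B -> exists2 A, Q A & B `<=` A.

Section Ideals.
Variable G : bidirected_graph.
Implicit Types (A L U : set (contributor G)) (M m x y : contributor G).

Definition lower_ideal A M : set (contributor G) := [set c | A c /\ le_a c M].
Definition upper_ideal A m : set (contributor G) := [set c | A c /\ le_a m c].

Definition is_bottom A x : Prop := A x /\ forall y, A y -> le_a x y.
Definition is_top A x : Prop := A x /\ forall y, A y -> le_a y x.

Definition is_meet A M m x : Prop :=
  [/\ A x, le_a x M, le_a x m &
      forall y, A y -> le_a y M -> le_a y m -> le_a y x].
Definition is_join A M m x : Prop :=
  [/\ A x, le_a M x, le_a m x &
      forall y, A y -> le_a M y -> le_a m y -> le_a x y].

Definition complementary A M m : Prop :=
  (exists2 x, is_bottom A x & is_meet A M m x) /\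
  (exists2 x, is_top A x & is_join A M m x).

(* L is a principal lower ideal, U a principal upper ideal or empty, and they
   are boolean complements in A; when U is empty this says L = A. *)
Definition complementary_ideals A L U : Prop :=
  [/\ L `|` U = A, L `&` U = set0 &
      exists M, [/\ A M, L = lower_ideal A M &
        U = set0 \/
        exists m, [/\ A m, U = upper_ideal A m & complementary A M m]]].

End Ideals.

(* Main.v *)
(** Unpacking and packing keep the tail incidences, so fix them, and let [far v] be the vertex reached
    from [v] when [v] is unpacked. A contributor with these tail incidences is the same as its set [S]
    of unpacked vertices, and the sets that occur are exactly the solutions of [far @: S = S], the unions
    of cycles of [far]; they are closed under union, intersection and difference. Activating a circle adds
    one cycle to [S], so [le_a] is inclusion and an activation class consists of all contributors with
    given tail incidences. The head of [u] moves exactly when [u] lies in [S] and on a cycle [X] of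
    length at least 2: these contributors form the upper ideal of [X], and the others the lower ideal of
    the union of all cycles other than [X]. *)

Require Import Defs.
From mathcomp Require Import all_boot fingroup perm.
From Stdlib Require Import Relation_Operators.

Set Implicit Arguments.
Unset Strict Implicit.
Unset Printing Implicit Defensive.

Local Notation iota := Defs.iota.

(** * Finite sets that a map sends onto themselves *)

Section Stable.
Variables (T : finType) (f : T -> T).
Implicit Types S X : {set T}.

Definition stable S := f @: S == S.

Lemma stable_inj S : stable S -> {in S &, injective f}.
Proof. by move=> /eqP fS; apply/imset_injP; rewrite fS. Qed.

Lemma stable0 : stable set0.
Proof. by rewrite /stable imset0. Qed.

Lemma stableU S X : stable S -> stable X -> stable (S :|: X).
Proof. by rewrite /stable imsetU => /eqP -> /eqP ->. Qed.

(** Injectivity across two sets comes from their union, which is stable as well. *)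
Lemma stable_injU S X : stable S -> stable X -> {in S & X, injective f}.
Proof.
move=> sS sX x y xS yX.
by apply: (stable_inj (stableU sS sX)); rewrite inE ?xS ?yX ?orbT.
Qed.

Lemma stableI S X : stable S -> stable X -> stable (S :&: X).
Proof.
move=> sS sX; rewrite /stable imsetI; last exact: stable_injU.
by rewrite (eqP sS) (eqP sX).
Qed.

(** A point of [S] outside [X] cannot map into [X]: its image would also be the image of a point of
    [X], against injectivity on the union. Counting then turns the inclusion into an equality. *)
Lemma stableD S X : stable S -> stable X -> stable (S :\: X).
Proof.
move=> sS sX; rewrite /stable eqEcard card_in_imset ?leqnn ?andbT; last first.
  by move=> x y /setDP[xS _] /setDP[yS _]; apply: (stable_inj sS).
apply/subsetP => _ /imsetP[x /setDP[xS xX] ->]; rewrite inE -(eqP sS) imset_f //.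
rewrite andbT; apply: contra xX; rewrite -{1}(eqP sX) => /imsetP[y yX fxy].
by rewrite (stable_injU sS sX xS yX fxy).
Qed.

(** This set becomes the top element of an activation class. *)
Definition max_stable := \bigcup_(S | stable S) S.

Lemma stable_max : stable max_stable.
Proof. by apply: (big_ind stable); [exact: stable0 | exact: stableU | ]. Qed.

Lemma sub_max_stable S : stable S -> S \subset max_stable.
Proof. exact: bigcup_sup. Qed.

End Stable.

(** * Cycles of a permutation *)

Section Porbit.
Variables (T : finType) (g : {perm T}).

Lemma porbit_sub (S : {set T}) x :
  x \in S -> {in S, forall y, g y \in S} -> porbit g x \subset S.
Proof.
move=> xS gS; apply/subsetP => _ /porbitP[n ->].
by elim: n => [|n IHn]; rewrite ?perm1 // expgSr permM gS.
Qed.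

Lemma eq_in_porbit (h : {perm T}) (S : {set T}) x :
    x \in S -> {in S, forall y, g y \in S} -> {in S, g =1 h} ->
  porbit g x = porbit h x.
Proof.
move=> xS gS gh.
have E n : (g ^+ n)%g x \in S /\ (g ^+ n)%g x = (h ^+ n)%g x.
  elim: n => [|n [IHS IH]]; first by rewrite !perm1.
  by rewrite !expgSr !permM -IH -gh // gS.
by apply/setP => y; apply/porbitP/porbitP => -[n ->]; exists n; case: (E n).
Qed.

Lemma stable_porbit (f : T -> T) x :
  {in porbit g x, f =1 g} -> stable f (porbit g x).
Proof.
move=> fg; rewrite /stable (eq_in_imset fg) eqEcard card_imset ?leqnn ?andbT; last exact: perm_inj.
apply/subsetP => _ /imsetP[y yx ->]; move: yx; rewrite -!eq_porbit_mem => /eqP <-.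
by rewrite (porbit_perm g 1).
Qed.

End Porbit.

(** * Pre-contributors as tail incidences together with a set of unpacked vertices *)

Section Incidences.
Variable G : bidirected_graph.
Implicit Types (i j : incidence G) (x y : p1map G) (p q : precontributor G).

(** The other incidence of the edge of [i]. It always exists, so the default [i] is never taken. *)
Definition mate i : incidence G :=
  odflt i [pick j | (j != i) && ((iota j).2 == (iota i).2)].

Lemma mateP i j : (j != i) && ((iota j).2 == (iota i).2) = (j == mate i).
Proof.
have: #|[predD1 [pred j | (iota j).2 == (iota i).2] & i]| = 1.
  have := edge_two_incidences (iota i).2.
  by rewrite (cardD1 i) inE /= eqxx add1n => -[].
move=> /mem_card1[k Ek].
have {}Ek l : (l != i) && ((iota l).2 == (iota i).2) = (l == k).
  by have := Ek l; rewrite !inE.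
rewrite Ek /mate; case: pickP => [l | /(_ k)]; first by rewrite Ek => /eqP ->.
by rewrite Ek eqxx.
Qed.

Lemma p1seqE x : p1seq x =
  ((iota (p1tail_inc x)).1, p1tail_inc x, (iota (p1tail_inc x)).2,
   p1head_inc x, (iota (p1head_inc x)).1).
Proof.
by case: x => -[[[[v i] e] j] w] Px; case/andP: (Px) => /eqP Ei /eqP Ej;
   rewrite /p1tail_inc /p1head_inc /= Ei Ej.
Qed.

Lemma p1tailE x : p1tail x = (iota (p1tail_inc x)).1.
Proof. by rewrite {1}/p1tail p1seqE. Qed.

Lemma p1headE x : p1head x = (iota (p1head_inc x)).1.
Proof. by rewrite {1}/p1head p1seqE. Qed.

Lemma p1head_incE x : p1head_inc x =
  if directed_adjacency x then mate (p1tail_inc x) else p1tail_inc x.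
Proof.
rewrite /directed_adjacency; case: eqVneq => //= ne.
apply/eqP; rewrite -mateP eq_sym ne /=.
by case: x {ne} => -[[[[v i] e] j] w] Px; case/andP: (Px) => /eqP Ei /eqP Ej;
   rewrite /p1tail_inc /p1head_inc /= Ei Ej.
Qed.

(** The tail incidence fixes tail and edge; the head incidence is then either the same one or its
    mate. *)
Lemma p1map_eq x y :
    p1tail_inc x = p1tail_inc y ->
    directed_adjacency x = directed_adjacency y ->
  x = y.
Proof.
by move=> Et Ed; apply: val_inj; rewrite /= !p1seqE !p1head_incE Et Ed.
Qed.

Definition tinc p v := p1tail_inc (p v).
Definition unpacked p : {set vertex G} := [set v | directed_adjacency (p v)].
Definition far p v : vertex G := (iota (mate (tinc p v))).1.

Lemma iota_tinc p v : (iota (tinc p v)).1 = v.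
Proof. by rewrite -p1tailE; apply/eqP/(forallP (pcfunP p)). Qed.

Lemma eq_far p q : tinc p =1 tinc q -> far p =1 far q.
Proof. by move=> E v; rewrite /far E. Qed.

Lemma precontributor_eq p q :
  tinc p =1 tinc q -> unpacked p = unpacked q -> p = q.
Proof.
move=> Et /setP Eu; apply/val_inj/ffunP => v; apply: p1map_eq (Et v) _.
by have := Eu v; rewrite !inE.
Qed.

Lemma cheadE p v : chead p v = if v \in unpacked p then far p v else v.
Proof.
rewrite /chead p1headE p1head_incE inE; case: ifP => // _.
exact: iota_tinc.
Qed.

(** Only the tail incidences of [p] enter; which vertices [p] itself unpacks is forgotten. *)
Definition repack_head p (S : {set vertex G}) v :=
  if v \in S then mate (tinc p v) else tinc p v.

Lemma repack_proof p S v :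
  incidence_preserving (v, tinc p v, (iota (tinc p v)).2, repack_head p S v,
                        (iota (repack_head p S v)).1).
Proof.
apply/andP; split; first by rewrite -{2}(iota_tinc p v) -surjective_pairing.
rewrite /repack_head; case: ifP => _; last by rewrite -surjective_pairing.
have := eqxx (mate (tinc p v)); rewrite -{1}mateP => /andP[_ /eqP <-].
by rewrite -surjective_pairing.
Qed.

Lemma repack_tail p S :
  [forall v, p1tail ([ffun v => P1Map (repack_proof p S v)] v) == v].
Proof. by apply/forallP => v; rewrite ffunE. Qed.

Definition repack p S := Precontributor (repack_tail p S).

Lemma tinc_repack p S : tinc (repack p S) =1 tinc p.
Proof. by move=> v; rewrite {1}/tinc /= ffunE. Qed.

Lemma unpacked_repack p S : unpacked (repack p S) = S.
Proof.
apply/setP => v; rewrite inE /= ffunE /directed_adjacency /p1tail_inc /p1head_inc /=.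
rewrite /repack_head; case: ifP; rewrite ?eqxx // => _.
by have := eqxx (mate (tinc p v)); rewrite -{1}mateP eq_sym => /andP[].
Qed.

Lemma unpack_atP v p q :
  unpack_at v p q <->
  [/\ v \notin unpacked p, tinc q =1 tinc p & unpacked q = v |: unpacked p].
Proof.
split=> [[bp dq tq Eq] | [vp tq uq]].
  split; first by rewrite inE negbK.
    by move=> w; have [-> //|/Eq Ew] := eqVneq w v; rewrite /tinc Ew.
  by apply/setP => w; rewrite !inE; have [-> //|/Eq -> //] := eqVneq w v.
split; first by move: vp; rewrite inE negbK.
- by have: v \in unpacked q; [rewrite uq setU11 | rewrite inE].
- exact: tq.
move=> w wv; apply: p1map_eq; first exact: tq.
by have /setP/(_ w) := uq; rewrite !inE (negPf wv).
Qed.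

(** Only packed vertices can be unpacked and none is packed again, so each occurs at most once and
    their order does not affect the result. *)
Lemma unpack_seqP s p q :
  unpack_seq s p q <->
  [/\ uniq s, [disjoint s & unpacked p], tinc q =1 tinc p &
      unpacked q = unpacked p :|: [set v in s]].
Proof.
elim: s p => [|v s IHs] p.
  split=> [<- | [_ _ tq uq]].
    split=> //; first by apply/pred0P.
    by apply/setP => v; rewrite !inE in_nil orbF.
  apply: precontributor_eq => [w|]; first by rewrite tq.
  by rewrite uq; apply/setP => w; rewrite !inE in_nil orbF.
rewrite /= disjoint_has /=; split.
  case=> r /unpack_atP[vp tr ur] /IHs[us ds tq uq].
  move: ds; rewrite disjoint_has ur => /hasPn ds.
  have vs : v \notin s by apply/negP => /ds; rewrite setU11.
  split; rewrite ?vs //.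
  - rewrite negb_or vp; apply/hasPn => w /ds; apply: contra; exact: setU1r.
  - by move=> w; rewrite tq tr.
  - by rewrite uq ur; apply/setP => w; rewrite !inE orbCA orbA.
case=> /andP[vs us]; rewrite negb_or => /andP[vp /hasPn ds] tq uq.
(* The intermediate state after unpacking [v] alone; it need not be a contributor. *)
exists (repack p (v |: unpacked p)).
  by apply/unpack_atP; split=> //; [exact: tinc_repack | exact: unpacked_repack].
apply/IHs; rewrite unpacked_repack; split=> //.
- rewrite disjoint_has; apply/hasPn => w ws; rewrite !inE negb_or.
  rewrite (memPn vs) //=; by have := ds _ ws; rewrite inE.
- by move=> w; rewrite tq tinc_repack.
- by rewrite uq; apply/setP => w; rewrite !inE orbCA orbA.
Qed.

End Incidences.

(** * Contributors as stable sets, and activation as inclusion *)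

Section Contributors.
Variable G : bidirected_graph.
Implicit Types (p : precontributor G) (c d : contributor G).

(** The injective map [chead c] fixes every packed vertex, so it cannot send an unpacked vertex to a
    packed one. *)
Lemma unpacked_stable c : stable (far c) (unpacked c).
Proof.
have E v : v \in unpacked c -> far c v = chead c v by rewrite cheadE => ->.
rewrite /stable (eq_in_imset E) eqEcard card_imset ?leqnn ?andbT; last exact: chead_inj.
apply/subsetP => _ /imsetP[v vc ->]; apply/negPn/negP => hc.
have: chead c (chead c v) = chead c v by rewrite {1}cheadE (negPf hc).
by move/chead_inj => E'; rewrite E' vc in hc.
Qed.

(** Vertices of [S] are heads by stability, all others are their own heads. *)
Lemma repack_surj p S : stable (far p) S ->
  (chead (repack p S) @: [set: vertex G])%SET == [set: vertex G]%SET.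
Proof.
move=> sS; rewrite eqEsubset subsetT /=; apply/subsetP => w _.
have [wS | wS] := boolP (w \in S).
  move: (wS); rewrite -{1}(eqP sS) => /imsetP[v vS ->]; apply/imsetP; exists v => //.
  by rewrite cheadE unpacked_repack vS (eq_far (tinc_repack p S)).
by apply/imsetP; exists w; rewrite // cheadE unpacked_repack (negPf wS).
Qed.

Lemma contributor_of_stable c S : stable (far c) S ->
  exists d, tinc d =1 tinc c /\ unpacked d = S.
Proof.
move=> sS; exists (Contributor (repack_surj sS)); split.
  exact: tinc_repack.
exact: unpacked_repack.
Qed.

Lemma contributor_eq c d :
  tinc c =1 tinc d -> unpacked c = unpacked d -> c = d.
Proof. by move=> Et Eu; apply/val_inj/precontributor_eq. Qed.

Lemma head_permE c v : v \in unpacked c -> head_perm c v = far c v.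
Proof. by rewrite permE cheadE => ->. Qed.

Lemma head_perm_unpacked c : {in unpacked c, forall v, head_perm c v \in unpacked c}.
Proof. by move=> v vc; rewrite head_permE // -(eqP (unpacked_stable c)) imset_f. Qed.

Lemma porbit_unpacked c v : v \in unpacked c -> porbit (head_perm c) v \subset unpacked c.
Proof. by move=> vc; apply: porbit_sub => //; apply: head_perm_unpacked. Qed.

Lemma stable_circle c v : v \in unpacked c -> stable (far c) (porbit (head_perm c) v).
Proof.
move=> vc; apply: stable_porbit => w /(subsetP (porbit_unpacked vc)) wc.
by rewrite head_permE.
Qed.

(** On [unpacked c] the permutation agrees with [far c], so it keeps [unpacked c :&: S]
    invariant. *)
Lemma circle_min c v S :
    v \in unpacked c -> stable (far c) S -> v \in S ->
  porbit (head_perm c) v \subset S.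
Proof.
move=> vc sS vS; apply: (@subset_trans _ _ (mem (unpacked c :&: S))); last exact: subsetIr.
apply: porbit_sub => [|w /setIP[wc wS]]; first by rewrite in_setI vc.
by rewrite in_setI head_perm_unpacked //= head_permE // -(eqP sS) imset_f.
Qed.

(** The cycle of a packed vertex is a single backstep, while a cycle through an unpacked vertex
    contains only unpacked vertices, even when it is a loop. *)
Lemma tcE c : tc c = #|[set porbit (head_perm c) v | v in unpacked c]|.
Proof.
apply: eq_card => X; rewrite inE; apply/andP/imsetP.
  case=> /imsetP[v _ ->]; rewrite negb_exists => /forallP/(_ v) Nv.
  exists v => //; apply: contraR Nv => vc; apply/andP; split; last first.
    by move: vc; rewrite inE negbK.
  rewrite eqEsubset sub1set porbit_id andbT.
  apply: porbit_sub => [|w]; first exact: set11.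
  by move=> /set1P ->; rewrite permE cheadE (negPf vc) set11.
case=> v vc ->; split; first exact: imset_f.
apply/existsPn => w; apply/negP => /andP[/eqP E bw].
have := subsetP (porbit_unpacked vc) w; rewrite E set11 => /(_ isT).
by rewrite inE /directed_adjacency -/(backstep _) bw.
Qed.

Lemma eq_circle c d v :
    tinc c =1 tinc d -> unpacked c \subset unpacked d -> v \in unpacked c ->
  porbit (head_perm c) v = porbit (head_perm d) v.
Proof.
move=> Et sub vc; apply: (eq_in_porbit vc); first exact: head_perm_unpacked.
move=> w wc; rewrite !head_permE ?(subsetP sub) //; exact: eq_far.
Qed.

(** Unpacking the vertices of the circle one by one, in any order, keeps the circles of [c] and adds
    just this one. *)
Lemma activates_circle c d v :
    v \in unpacked d -> v \notin unpacked c -> tinc d =1 tinc c ->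
    unpacked d = unpacked c :|: porbit (head_perm d) v ->
  activates c d.
Proof.
set X := porbit _ v => vd vc Et Eu.
have sX : stable (far c) X.
  by rewrite /stable -(eq_imset _ (eq_far Et)); apply: stable_circle.
have disXc : [disjoint X & unpacked c].
  (* The difference is stable and contains [v], so by minimality it is the whole circle. *)
  suff : X \subset X :\: unpacked c by rewrite subsetD subxx.
  apply: circle_min => //; last by rewrite in_setD vc porbit_id.
  rewrite /stable (eq_imset _ (eq_far Et)); apply: stableD => //.
  exact: unpacked_stable.
exists (enum X).
  split.
    apply/unpack_seqP; split=> //; first exact: enum_uniq.
    - by rewrite (eq_disjoint (mem_enum X)).
    - by rewrite Eu; apply/setP => w; rewrite !inE mem_enum.
  rewrite !tcE Eu imsetU.
  have -> : [set porbit (head_perm d) w | w in X] = [set X].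
    apply/setP => Y; rewrite in_set1; apply/imsetP/eqP => [[w wX ->]|->].
      by apply/eqP; rewrite eq_porbit_mem.
    by exists v; rewrite ?porbit_id.
  have -> : [set porbit (head_perm d) w | w in unpacked c] =
            [set porbit (head_perm c) w | w in unpacked c].
    apply: eq_in_imset => w wc; apply/esym/eq_circle => //.
    by rewrite Eu subsetUl.
  (* The new circle is not one of [c], since it contains [v], which is packed in [c]. *)
  rewrite setUC cardsU1; case: imsetP => [[w wc E]|//].
  have := subsetP (porbit_unpacked wc) v.
  by rewrite -E porbit_id (negPf vc) => /(_ isT).
(* A subsequence that leads to a contributor is stable, so it is empty or the
   whole cycle; if it is empty, no circle is added. *)
move=> t d' st [/unpack_seqP[ut dt tt Ed'] tcd'].
have stX : [set w in t] \subset X.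
  by apply/subsetP => w; rewrite inE => /(mem_subseq st); rewrite mem_enum.
have sT : stable (far c) [set w in t].
  (* As [X] avoids [unpacked c], everything that [d'] unpacks in [X] comes from [t]. *)
  have -> : [set w in t] = unpacked d' :&: X.
    rewrite Ed' setIUl (setIC (unpacked c)); move: disXc; rewrite -setI_eq0 => /eqP ->.
    by rewrite set0U; apply/esym/setIidPl.
  apply: stableI sX; rewrite /stable -(eq_imset _ (eq_far tt)); exact: unpacked_stable.
have [w wt | t0] := pickP (mem t); last first.
  have E : d' = c.
    apply: contributor_eq => //; rewrite Ed'; apply/setP => w.
    by rewrite in_setU in_set; move: (t0 w) => /= ->; rewrite orbF.
  by move: tcd'; rewrite E => /eqP; rewrite -[X in X == _]addn0 -addn1 eqn_add2l.
have wX : w \in X by apply: (subsetP stX); rewrite inE.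
have XE : X = porbit (head_perm d) w by apply/eqP; rewrite eq_porbit_mem porbit_sym.
have sXt : X \subset [set w in t].
  rewrite XE; apply: circle_min; last by rewrite inE.
    by rewrite Eu inE wX orbT.
  by rewrite /stable (eq_imset _ (eq_far Et)).
apply/eqP; rewrite -(size_subseq_leqif st).2.
rewrite eqn_leq (size_subseq st) -cardE -(card_uniqP ut).
by apply: subset_leq_card; apply/subsetP => y /(subsetP sXt); rewrite inE.
Qed.

(** For the converse, activate in [c] the circle of [d] through some vertex that only [d] unpacks,
    and induct on the number of such vertices. *)
Lemma le_aP c d :
  le_a c d <-> tinc c =1 tinc d /\ unpacked c \subset unpacked d.
Proof.
split.
  elim=> {c d} [c d [s [/unpack_seqP[_ _ td ud] _] _] | // | c1 c2 c3 _ [t1 u1] _ [t2 u2]].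
    by split=> [v|]; rewrite ?td // ud subsetUl.
  by split=> [v|]; [rewrite t1 t2 | apply: subset_trans u1 u2].
have [n] := ubnP #|unpacked d :\: unpacked c|.
elim: n c => // n IHn c; rewrite ltnS => len [Et sub].
have [E | /set0Pn[v]] := eqVneq (unpacked d :\: unpacked c) set0.
  have -> : c = d; last exact: rt_refl.
  by apply: contributor_eq => //; apply/eqP; rewrite eqEsubset sub -setD_eq0 E eqxx.
move=> vdc; have /setDP[vd vc] := vdc.
set X := porbit (head_perm d) v.
have sX : stable (far c) (unpacked c :|: X).
  apply: stableU; first exact: unpacked_stable.
  by rewrite /stable (eq_imset _ (eq_far Et)); apply: stable_circle.
have [c' [Et' Eu']] := contributor_of_stable sX.
have tc'd : tinc c' =1 tinc d by move=> w; rewrite Et' Et.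
have sub' : unpacked c' \subset unpacked d.
  by rewrite Eu' subUset sub; apply: porbit_unpacked.
have vc' : v \in unpacked c' by rewrite Eu' inE porbit_id orbT.
apply: (@rt_trans _ _ _ c').
  apply: rt_step; apply: (activates_circle vc' vc Et').
  by rewrite (eq_circle tc'd sub' vc').
apply: IHn => //; apply: leq_trans len; apply: proper_card.
apply/properP; split; last by exists v; rewrite // inE vc'.
by apply: setDS; rewrite Eu' subsetUl.
Qed.

Lemma contributor_bottom c : exists2 b : contributor G, tinc b =1 tinc c & unpacked b = set0.
Proof.
by have [b [? ?]] := contributor_of_stable (stable0 (far c)); exists b.
Qed.

(** Contributors with equal tail incidences lie above the same fully packed contributor. *)
Lemma sim_aP c d : sim_a c d <-> tinc c =1 tinc d.
Proof.
split.
  elim=> {c d} [c d /le_aP[] // | // | c d _ E v | c1 c2 c3 _ E _ E' v].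
    by rewrite E.
  by rewrite E E'.
move=> E; have [b tb ub] := contributor_bottom c.
apply: (@rst_trans _ _ _ b); [apply: rst_sym|]; apply: rst_step; apply/le_aP;
  by rewrite ub sub0set; split=> // v; rewrite tb ?E.
Qed.

End Contributors.

From mathcomp Require Import boolp classical_sets.

(** * The two complementary ideals of an activation class *)

Section Complement.
Variables (G : bidirected_graph) (a : contributor G) (u : vertex G).

Local Notation A := (sim_a a : set (contributor G)).

Lemma sim_a_le_aP c d : A c -> A d -> le_a c d <-> unpacked c \subset unpacked d.
Proof.
move=> /sim_aP Ec /sim_aP Ed; rewrite le_aP; split=> [[]|] //.
by split=> // v; rewrite -Ec Ed.
Qed.

Lemma sim_a_of_stable S : stable (far a) S -> exists2 c : contributor G, A c & unpacked c = S.
Proof.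
case/contributor_of_stable=> c [tc uc]; exists c => //.
by apply/sim_aP => v; rewrite tc.
Qed.

Lemma sim_a_stable c : A c -> stable (far a) (unpacked c).
Proof.
by move=> /sim_aP/eq_far E; rewrite /stable (eq_imset _ E); apply: unpacked_stable.
Qed.

Lemma sim_a_chead c : A c -> chead c u = if u \in unpacked c then far a u else u.
Proof. by move=> /sim_aP/eq_far E; rewrite cheadE E. Qed.

Local Open Scope classical_set_scope.

Let L := [set c | A c /\ chead c u = u].
Let U := [set c | A c /\ chead c u <> u].

Lemma complementary_ideals_head : complementary_ideals A L U.
Proof.
split.
- apply/seteqP; split=> [c [[]|[]] // | c Ac].
  by have [E | /eqP E] := eqVneq (chead c u) u; [left | right].
- by apply/seteqP; split=> // c [[_ E] [_ []]].
have [t At Et] := sim_a_of_stable (stable_max (far a)).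
have topt c : A c -> unpacked c \subset unpacked t.
  by move=> Ac; rewrite Et; apply: sub_max_stable; apply: sim_a_stable.
(* If no member moves [u], the lower ideal of the top [t] is the whole class. *)
have [[d [Ad dU]] | noU] := pselect (exists d, U d); last first.
  exists t; split=> //.
    apply/seteqP; split=> c [Ac _]; split=> //.
      by apply/sim_a_le_aP => //; apply: topt.
    by apply: contrapT => cu; apply: noU; exists c.
  by left; apply/seteqP; split=> // c Uc; case: noU; exists c.
have [ud fu] : u \in unpacked d /\ far a u <> u.
  by move: dU; rewrite sim_a_chead //; case: ifP.
(* Since [far a u] differs from [u], the head of [u] tells whether [u] is unpacked. *)
have {}noU c : A c -> chead c u = u <-> u \notin unpacked c.
  by move=> Ac; rewrite sim_a_chead //; case: ifP.
have Ed : far a =1 far d by apply: eq_far; apply/sim_aP.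
set X := porbit (head_perm d) u.
have sX : stable (far a) X by rewrite /stable (eq_imset _ Ed); apply: stable_circle.
have minX S : stable (far a) S -> u \in S -> X \subset S.
  by rewrite /stable (eq_imset _ Ed); apply: circle_min.
have uX : u \in X by apply: porbit_id.
(* The generators: [m] unpacks only the cycle [X] of [u], and [M] all other cycles. *)
have [m Am Em] := sim_a_of_stable sX.
have [M AM EM] := sim_a_of_stable (stableD (stable_max (far a)) sX).
have [b Ab Eb] := sim_a_of_stable (stable0 (far a)).
exists M; split=> //.
  apply/seteqP; split=> c [Ac Hc]; split=> //.
    apply/sim_a_le_aP => //; rewrite EM -Et subsetD topt //=.
    move/noU: Hc => /(_ Ac) uc; rewrite disjoint_sym.
    (* If [u] is packed in [c], then [X :\: unpacked c] is stable and contains [u], so [X] is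
       disjoint from [unpacked c]. *)
    have := minX _ (stableD sX (sim_a_stable Ac)).
    by rewrite inE uc uX => /(_ isT); rewrite subsetD => /andP[].
  apply/noU => //; move/(sim_a_le_aP Ac AM): Hc; rewrite EM subsetD => /andP[_].
  by move=> /disjointFl -> .
right; exists m; split=> //.
  apply/seteqP; split=> c [Ac Hc]; split=> //.
    apply/sim_a_le_aP => //; rewrite Em; apply: minX; first exact: sim_a_stable.
    by apply/negPn/negP => /noU => /(_ Ac).
  move/(noU _ Ac); move/(sim_a_le_aP Am Ac): Hc; rewrite Em => /fintype.subsetP/(_ u uX).
  by move=> ->.
have bot y : A y -> le_a b y by move=> Ay; apply/sim_a_le_aP; rewrite // Eb finset.sub0set.
have top y : A y -> le_a y t by move=> Ay; apply/sim_a_le_aP => //; apply: topt.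
split; [exists b | exists t] => //; split=> //; try exact: bot; try exact: top.
  move=> y Ay /(sim_a_le_aP Ay AM) yM /(sim_a_le_aP Ay Am) ym.
  apply/sim_a_le_aP => //; rewrite Eb.
  have : unpacked y \subset unpacked M :&: unpacked m by rewrite finset.subsetI yM.
  by rewrite EM Em finset.setDE -finset.setIA (finset.setIC (~: X)) finset.setICr finset.setI0.
move=> y Ay /(sim_a_le_aP AM Ay) My /(sim_a_le_aP Am Ay) my.
apply/sim_a_le_aP => //; rewrite Et.
have : unpacked M :|: unpacked m \subset unpacked y by rewrite finset.subUset My.
rewrite EM Em; apply: fintype.subset_trans; apply/fintype.subsetP => v vS; rewrite !inE vS.
by rewrite andbT orNb.
Qed.

End Complement.

(** * Blocks of the refinement inside an activation class *)

Local Open Scope classical_set_scope.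

Theorem theorem3p11 (G : bidirected_graph) (hG : components_have_adjacency G)
    (u : vertex G) :
  refines (quotient (@sim_from_a G u)) (quotient (@sim_a G)) /\
  forall A : set (contributor G), quotient (@sim_a G) A ->
    exists L U : set (contributor G),
      [/\ forall B : set (contributor G),
            (quotient (@sim_from_a G u) B /\ B `<=` A) <->
            (B !=set0 /\ (B = L \/ B = U)),
          L = [set c | A c /\ chead c u = u],
          complementary_ideals A L U &
          U = set0 <-> forall c, A c -> chead c u = u].
Proof.
split=> [_ [c ->] | _ [a ->]].
  by exists [set d | sim_a c d]; [exists c | move=> d []].
exists [set c | sim_a a c /\ chead c u = u], [set c | sim_a a c /\ chead c u <> u].
have simE c d : sim_a a c -> sim_a c d <-> sim_a a d.
  by move=> /sim_aP E; rewrite !sim_aP; split=> E' v; have := E v; rewrite E'.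
have blockE c : sim_a a c ->
    [set d | sim_from_a u c d] = [set d | sim_a a d /\ chead d u = chead c u].
  move=> Ac; apply/seteqP; split=> d.
    by case=> -[w [Ec Ed]] /(simE _ _ Ac) Ad; split; rewrite ?Ec.
  by case=> /(simE _ _ Ac) Acd E; split=> //; exists (chead c u).
split=> //.
- move=> B; split.
    case=> -[c ->] sub.
    have cc : sim_from_a u c c by split; [exists (chead c u) | apply/sim_aP].
    have Ac := sub _ cc.
    split; first by exists c.
    rewrite blockE //; have [E | /eqP E] := eqVneq (chead c u) u.
      by left; rewrite E.
    right; apply/seteqP; split=> d [Ad]; first by move=> /= ->.
    (* Within the class the head of [u] is [u] or [far a u], so all members that move [u] share one
       head and form a single block. *)
    move: E; rewrite /= !(sim_a_chead u (a := a)) //.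
    by case: ifP; case: ifP.
  (* Conversely, a nonempty [L] or [U] is the block of any of its members. *)
  case=> -[c Bc] BLU; suff E : B = [set d | sim_from_a u c d].
    by split; [exists c | case: BLU => -> d []].
  case: BLU Bc => -> [Ac Ec]; rewrite blockE // ; first by rewrite Ec.
  apply/seteqP; split=> d [Ad]; last by move=> /= ->.
  move: Ec; rewrite /= !(sim_a_chead u (a := a)) //.
  by case: ifP; case: ifP.
- exact: complementary_ideals_head.
split=> [U0 c Ac | H]; last by apply/seteqP; split=> // c [/H].
by apply: contrapT => cu; have : set0 c by rewrite -U0.
Qed.
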